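(* Let $F:\mathbb R_{\ge0}\to\mathbb R_{\ge0}$ be an increasing function with $\lim_{x\to\infty}F(x)/x=+\infty$, let $F^*(y)=\sup_{x\ge0}(xy-F(x))$, and let $M_F(z)=\sum_{n=1}^{\infty}\frac{z^n}{n^2}e^{-F^*(n)}$. Let $g(s)=\sum_{n=1}^{\infty}g_n n^{-s}$ be a Dirichlet series converging absolutely for $\mathrm{Re}\,s>1$ with $g_n\ge 1$ for all $n$. Then the series $M_F(g(s))$ converges for $\mathrm{Re}\,s>1$ and is a Dirichlet series $\sum_{n\ge1}a_n n^{-s}$, and for all sufficiently large $x$ the inequality $$\sup_{n\le x}a_n\ge \exp\Big(\log k\,\frac{\log x}{\log\log x}-F^*(k)\Big)$$ holds for every natural number $k$. *)

(* Defs.v *)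
From HB Require Import structures.
From mathcomp Require Export all_boot all_order all_algebra.
From mathcomp Require Export all_classical all_reals all_analysis.
From mathcomp Require Export complex.

Set Implicit Arguments.
Unset Strict Implicit.
Unset Printing Implicit Defensive.

Export Order.TTheory GRing.Theory Num.Theory numFieldNormedType.Exports.

#[export] Set Warnings "-notation-overridden".
Local Open Scope classical_set_scope.
Local Open Scope complex_scope.
Local Open Scope ring_scope.

(* The norm topology on the complex numbers is only available through the
   regular module [R[i]^o], which is convertible to [R[i]]. *)
Notation cplx R := (R[i]^o).

(* Only the values of [F] on [0, +oo[ matter. The supremum is a real number
   when [F] is superlinear, see [has_sup_conjugate]. *)
Definition conjugate (R : realType) (F : R -> R) (y : R) : R :=
  sup [set x * y - F x | x in [set x | 0 <= x]].

Definition cexp (R : realType) (z : R[i]) : R[i] :=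
  let: x +i* y := z in (expR x * cos y) +i* (expR x * sin y).

(* The [series] of the library start at index 0, hence the shift [n.+1] in the
   series below. *)
Definition dirichlet_term (R : realType) (a : nat -> R) (s : R[i]) :
    nat -> cplx R :=
  fun n => ((a n.+1)%:C * cexp (- s * (ln n.+1%:R)%:C) : R[i]).

Definition dirichlet (R : realType) (a : nat -> R) (s : R[i]) : cplx R :=
  limn (series (dirichlet_term a s)).

Definition M_term (R : realType) (F : R -> R) (z : R[i]) : nat -> cplx R :=
  fun n =>
    (z ^+ n.+1 / n.+1%:R ^+ 2 * (expR (- conjugate F n.+1%:R))%:C : R[i]).

Definition M_ (R : realType) (F : R -> R) (z : R[i]) : cplx R :=
  limn (series (M_term F z)).

Lemma has_sup_conjugate (R : realType) (F : R -> R) (y : R) :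
  (forall x, 0 <= x -> 0 <= F x) -> (F x / x @[x --> +oo] --> +oo) ->
  has_sup [set x * y - F x | x in [set x | 0 <= x]].
Proof.
move=> F0 /cvgryPge/(_ y) [A [Ar HA]]; split; first by exists (0 * y - F 0), 0 => /=.
have M0 : 0 <= `|A| + 1 by rewrite addr_ge0.
exists ((`|A| + 1) * `|y|) => _ [x /= x0 <-].
have [xA|Ax] := leP x (`|A| + 1).
  rewrite (le_trans (_ : _ <= x * y)) ?lerBlDr ?lerDl ?F0//.
  by rewrite (le_trans (ler_wpM2l x0 (ler_norm y)))// ler_wpM2r.
have xgt0 : 0 < x by rewrite (le_lt_trans M0).
have : y <= F x / x.
  by apply: HA; rewrite (le_lt_trans (ler_norm A))// (lt_trans _ Ax)// ltrDl.
rewrite ler_pdivlMr// mulrC -subr_le0 => /le_trans; apply.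
by rewrite mulr_ge0.
Qed.

(* Main.v *)
(* The coefficient [a n] is the sum over [m] of [exp (- F^* m) / m ^ 2] times the
   [n]-th coefficient of [g ^ m], an [m]-fold Dirichlet convolution. As all these
   coefficients are nonnegative, the difference between [M_F (g s)] and a partial
   sum of the Dirichlet series of [a] at [s] is bounded in norm by the same
   difference for the moduli of [n ^ (- s)], so that convergence reduces to a
   monotone limit in the reals.
   For the lower bound, [g n >= 1] shows that [g ^ k] has a coefficient at least
   [k ^ omega(n)] at squarefree [n]. It remains to find a primorial [n <= x] with
   at least [ln x / ln (ln x) + 2] prime factors, the [2] absorbing [1 / k ^ 2].
   Write [theta y = ln (primorial y)] and [S = pi(y) ln y - theta y]. Chebyshev's
   lower bound on [pi] gives [S >= c y / ln y] with [c] close to [ln 2], whereas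
   replacing [ln y] by [ln (theta y)] costs at most about
   [theta y * ln (y / theta y) / ln y <= y / (2 ln y)], as [ln u <= u / 2]. Since
   [ln 2 > 1 / 2], no asymptotics of [theta] finer than Chebyshev's are needed. *)
Require Import Defs.
From mathcomp Require Import zify ring lra.
Set Implicit Arguments.
Unset Strict Implicit.
Unset Printing Implicit Defensive.

Local Open Scope classical_set_scope.
Local Open Scope complex_scope.
Local Open Scope ring_scope.

(** * Prime counting function and primorials *)

Section prime_counting.
Local Open Scope nat_scope.

Definition prime_count n := \sum_(0 <= p < n.+1 | prime p) 1.

Definition primorial n := \prod_(0 <= p < n.+1 | prime p) p.

Lemma prime_count0 : prime_count 0 = 0.
Proof. by rewrite /prime_count big_mkcond big_nat1. Qed.

Lemma primorial0 : primorial 0 = 1.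
Proof. by rewrite /primorial big_mkcond big_nat1. Qed.

Lemma prime_countS n : prime_count n.+1 = prime_count n + prime n.+1.
Proof.
by rewrite /prime_count big_mkcond big_nat_recr//= -big_mkcond/=; case: prime.
Qed.

Lemma primorialS n :
  primorial n.+1 = (if prime n.+1 then n.+1 else 1) * primorial n.
Proof.
by rewrite /primorial big_mkcond big_nat_recr//= -big_mkcond/= mulnC.
Qed.

Lemma primorial_gt0 n : 0 < primorial n.
Proof.
elim: n => [|n IH]; first by rewrite primorial0.
by rewrite primorialS muln_gt0 IH; case: ifP.
Qed.

Lemma sum_nat_leq_le n t : \sum_(1 <= j < n.+1) (j <= t) <= minn n t.
Proof.
elim: n => [|n IH]; first by rewrite big_geq.
by rewrite big_nat_recr//=; lia.
Qed.

(** Puts the Legendre sums for the factorials of [k], [m - k] and [m] on one range of exponents: the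
    added terms have [k < j < p ^ j]. *)
Lemma sum_divn_expl_widen p k m : prime p -> k <= m ->
  \sum_(1 <= j < m.+1) k %/ p ^ j = \sum_(1 <= j < k.+1) k %/ p ^ j.
Proof.
move=> pp km; rewrite (big_cat_nat (n := k.+1))//= [X in _ + X]big1_seq ?addn0//.
move=> j; rewrite mem_index_iota => /andP[_ /andP[kj _]].
by rewrite divn_small// (ltn_trans kj)// ltn_expl// prime_gt1.
Qed.

(* By Legendre's formula, [logn p 'C(m, k)] is a sum of terms [0] or [1], one
   for each [j] with [p ^ j <= m]. *)
Lemma expn_logn_bin p m k : prime p -> k <= m -> 0 < m ->
  p ^ logn p 'C(m, k) <= m.
Proof.
move=> pp km m0.
rewrite (leq_trans _ (trunc_logP (prime_gt1 pp) m0))// leq_exp2l ?prime_gt1//.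
have := congr1 (logn p) (bin_fact km).
rewrite lognM ?bin_gt0 ?muln_gt0 ?fact_gt0// lognM ?fact_gt0// !logn_fact//.
rewrite -(sum_divn_expl_widen pp km) -(sum_divn_expl_widen pp (leq_subr k m)).
(* Adding the sums for [k] and [m - k] to both sides avoids truncated subtraction. *)
move=> E; rewrite -(leq_add2r (\sum_(1 <= j < m.+1) k %/ p ^ j +
   \sum_(1 <= j < m.+1) (m - k) %/ p ^ j)) E.
apply: (@leq_trans (\sum_(1 <= j < m.+1) (j <= trunc_log p m) +
  (\sum_(1 <= j < m.+1) k %/ p ^ j + \sum_(1 <= j < m.+1) (m - k) %/ p ^ j))).
  rewrite -!big_split/=; apply: leq_sum => j _.
  rewrite -{1}(subnKC km) divnD ?expn_gt0 ?prime_gt0// addnC leq_add2r.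
  (* A carry at [j] means that the two remainders add up to at least [p ^ j], whence
     [p ^ j <= m]. *)
  case: (leqP (p ^ j) (k %% p ^ j + (m - k) %% p ^ j)) => //= h.
  rewrite lt0b; apply: trunc_log_max; first exact: prime_gt1.
  by rewrite (leq_trans h)// -[leqRHS](subnKC km) leq_add// leq_mod.
by rewrite leq_add2r (leq_trans (sum_nat_leq_le _ _))// geq_minr.
Qed.

(** Each prime power in the factorization is at most [m] by [expn_logn_bin], so only primes up to
    [m] occur. *)
Lemma bin_le_exp_prime_count m k : k <= m -> 0 < m -> 'C(m, k) <= m ^ prime_count m.
Proof.
move=> km m0.
have C0 : 0 < 'C(m, k) by rewrite bin_gt0.
rewrite {1}(prod_prime_decomp C0) prime_decompE big_map/=.
apply: (@leq_trans (\prod_(p <- primes 'C(m, k)) m)).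
  rewrite big_seq [leqRHS]big_seq; apply: leq_prod => p.
  by rewrite mem_primes => /and3P[pp _ _]; exact: expn_logn_bin.
rewrite big_const_seq count_predT iter_muln_1 leq_pexp2l//.
rewrite /prime_count -big_filter sum1_size uniq_leq_size ?primes_uniq// => p.
rewrite mem_primes mem_filter mem_index_iota ltnS => /and3P[pp _ pC].
rewrite pp/= (leq_trans _ (expn_logn_bin pp km m0))//.
by rewrite -[leqLHS]expn1 leq_exp2l ?prime_gt1// logn_gt0 mem_primes pp C0.
Qed.

Lemma exp2_le_exp_prime_count m : 0 < m -> 2 ^ m <= m.+1 * m ^ prime_count m.
Proof.
move=> m0; rewrite -[2]/(1 + 1) expnDn.
apply: (@leq_trans (\sum_(i < m.+1) m ^ prime_count m)).
  apply: leq_sum => i _; rewrite !exp1n !muln1.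
  by rewrite bin_le_exp_prime_count// -ltnS.
by rewrite sum_nat_const card_ord.
Qed.

End prime_counting.

(** * Chebyshev estimates *)

Section log_estimates.
Context {R : realType}.
Implicit Types x y : R.

Lemma ln_le_subr1 x : 0 < x -> ln x <= x - 1.
Proof.
by move=> x0; rewrite -{1}(subrKC 1 x) le_ln1Dx// ltrBrDl subrr.
Qed.

Lemma ln_succ_sub n : n.+2%:R^-1 <= ln n.+2%:R - ln n.+1%:R :> R.
Proof.
rewrite -ln_div ?posrE// -[leRHS]opprK -lnV ?posrE// invf_div lerNr.
rewrite (le_trans (ln_le_subr1 _))// -[n.+2]addn1 natrD.
have : (n.+1%:R + 1 : R) != 0 by rewrite gt_eqF// ltr_wpDl.
by move=> ?; rewrite le_eqVlt; apply/orP; left; apply/eqP; field.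
Qed.

(** Writing [2] as [6 / 3], the increments of [ln] from [3] to [6] give
    [1 / 4 + 1 / 5 + 1 / 6 = 37 / 60]. *)
Lemma ln2_ge : 3 / 5 <= ln 2 :> R.
Proof.
have -> : ln 2 = ln 6 - ln 3 :> R by rewrite -ln_div ?posrE//; congr ln; lra.
have := @ln_succ_sub 2; have := @ln_succ_sub 3; have := @ln_succ_sub 4.
lra.
Qed.

Lemma ln_lt_mul (e : R) : 0 < e -> \forall x \near +oo, ln x <= e * x.
Proof.
move=> e0; near=> x.
have x0 : 0 < x by near: x; exact: nbhs_pinfty_gt.
have e20 : 0 < e / 2 by rewrite divr_gt0.
have := @ln_le_subr1 (e / 2 * x); rewrite lnM ?posrE// => /(_ (mulr_gt0 _ _)).
(* The tangent bound is used with slope [e / 2]; the other half of [e * x] absorbs the constant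
   [- ln (e / 2)]. *)
have : - ln (e / 2) * (2 / e) <= x by near: x; apply: nbhs_pinfty_ge; rewrite num_real.
rewrite mulrA ler_pdivrMr//.
move=> h /(_ e20 x0); lra.
Unshelve. all: by end_near. Qed.

Lemma cvg_ln_pinfty : ln x @[x --> +oo_R] --> +oo.
Proof.
apply/cvgryPge => A; near=> x.
rewrite -ler_expR lnK ?posrE; last by near: x; exact: nbhs_pinfty_gt.
by near: x; apply: nbhs_pinfty_ge; rewrite num_real.
Unshelve. all: by end_near. Qed.

Lemma near_pinfty_ln (P : R -> Prop) :
  (\forall x \near +oo, P x) -> \forall x \near +oo, P (ln x).
Proof. by move=> /cvg_ln_pinfty. Qed.

Lemma near_pinfty_nat (P : R -> Prop) :
  (\forall x \near +oo, P x) -> \forall n \near \oo, P n%:R.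
Proof. by move=> /(@cvgr_idn R). Qed.

Lemma near_ln_ge x : \forall y \near +oo, x <= ln y.
Proof. by move/cvgryPge: cvg_ln_pinfty; apply. Qed.

Lemma sqr_ln_lt_mul (e : R) : 0 < e -> \forall x \near +oo, ln x ^+ 2 <= e * x.
Proof.
move=> e0; near=> x.
have x0 : 0 < x by near: x; exact: nbhs_pinfty_gt.
have l0 : 6 / e <= ln x.
  by near: x; exact: near_ln_ge.
have lge0 : 0 <= ln x by rewrite (le_trans _ l0)// divr_ge0// ltW.
(* The cubic Taylor term gives [ln x ^+ 3 <= 6 * x], and [6 / e <= ln x] removes one factor. *)
have := @expR_ge1Dxn R (ln x) 2 lge0; rewrite lnK ?posrE// => h.
have {}h : ln x ^+ 3 <= 6 * x.
  have /= : (3 `!)%N = 6%N by []; move: h => /[swap] ->; lra.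
rewrite ler_pdivrMr// in l0.
have := ler_wpM2l (sqr_ge0 (ln x)) l0; have := ler_wpM2l (ltW e0) h; lra.
Unshelve. all: by end_near. Qed.

Lemma ln_half x : 0 < x -> ln x <= x / 2.
Proof.
move=> x0; have := @ln_le_subr1 (x / 2); rewrite ln_div ?posrE// divr_gt0// => /(_ isT).
by have := @ln_le_subr1 2 (ltr0Sn _ 1); lra.
Qed.

(** As [1 <= ln x], one has [x * (ln y - ln x) <= y - x <= (y - x) * ln x], which rearranges to
    [x * ln y <= y * ln x]. *)
Lemma div_ln_nondecreasing x y : expR 1 <= x -> x <= y ->
  x / ln x <= y / ln y.
Proof.
move=> ex xy.
have x0 : 0 < x by rewrite (lt_le_trans _ ex)// expR_gt0.
have y0 := lt_le_trans x0 xy.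
have lx : 1 <= ln x by rewrite -ler_expR lnK.
have ly : 1 <= ln y by rewrite (le_trans lx)// ler_ln.
rewrite ler_pdivrMr ?(lt_le_trans _ lx)// mulrAC ler_pdivlMr ?(lt_le_trans _ ly)//.
have := @ln_le_subr1 (y / x); rewrite ln_div ?posrE// divr_gt0// => /(_ isT) h.
have {}h : x * (ln y - ln x) <= y - x.
  have -> : y - x = x * (y / x - 1) by rewrite mulrBr mulrCA divff ?gt_eqF// !mulr1.
  by rewrite ler_wpM2l// ltW.
have := mulr_ge0 (_ : 0 <= y - x) (_ : 0 <= ln x - 1); rewrite !subr_ge0 => /(_ xy lx).
lra.
Qed.

End log_estimates.

(** * Chebyshev's lower bound and primorials with many prime factors *)

Section chebyshev.
Context {R : realType}.

Lemma exp2_le_primorial n : (2 ^ prime_count n <= primorial n)%N.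
Proof.
elim: n => [|n IH]; first by rewrite prime_count0 primorial0.
rewrite prime_countS primorialS expnD mulnC leq_mul//.
by case: ifP => // /prime_gt1.
Qed.

Definition theta n : R := ln (primorial n)%:R.

Definition log_defect n : R := (prime_count n)%:R * ln n%:R - theta n.

Lemma prime_count_ln_ge n : (0 < n)%N ->
  n%:R * ln 2 - ln n.+1%:R <= (prime_count n)%:R * ln n%:R :> R.
Proof.
move=> n0; have := exp2_le_exp_prime_count n0.
rewrite -(ler_nat R) natrM !natrX => h.
have : ln (2 ^+ n) <= ln (n.+1%:R * n%:R ^+ prime_count n) :> R.
  by rewrite ler_ln// posrE ?mulr_gt0// exprn_gt0// ltr0n.
rewrite lnM ?posrE ?exprn_gt0 ?ltr0n// !lnXn ?ltr0n//.
by rewrite !mulr_natl; lra.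
Qed.

(** Abel summation: if [n.+1] is prime, its [ln n.+1] enters both terms of [log_defect] and cancels.
    Thus [log_defect] is the discrete integral of [prime_count t / t]. *)
Lemma log_defectS n :
  log_defect n.+1 = log_defect n + (prime_count n)%:R * (ln n.+1%:R - ln n%:R).
Proof.
rewrite /log_defect /theta prime_countS primorialS natrM natrD.
rewrite lnM ?posrE ?ltr0n ?primorial_gt0//; last by case: ifP.
by case: prime; rewrite ?ln1/=; lra.
Qed.

Lemma log_defect_ge0 n : 0 <= log_defect n.
Proof.
elim: n => [|n IH].
  by rewrite /log_defect /theta prime_count0 primorial0 ln1 mul0r subrr.
rewrite log_defectS addr_ge0// mulr_ge0// subr_ge0.
case: n {IH} => [|n]; first by rewrite ln1 ln0.
by rewrite ler_ln ?posrE// ler_nat.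
Qed.

(** By [prime_count_ln_ge] the count times [ln n] is about [3 / 5 * n] at least, and [ln] grows by
    at least [1 / n.+1]. The margin down to [59 / 100] pays for the error [ln n.+1 <= n.+1 / 200]
    and for dividing by [n.+1]. *)
Lemma log_defect_step : \forall n \near \oo,
  59 / 100 <= (prime_count n)%:R * (ln n.+1%:R - ln n%:R) * ln n%:R :> R.
Proof.
have c0 : 0 < 1 / 200 :> R by rewrite divr_gt0.
have [N _ HN] := near_pinfty_nat (ln_lt_mul c0).
exists (maxn N 1000) => // -[|n] /=; first lia.
rewrite geq_max => /andP[Nn n1000].
have /= hl := HN n.+2 (leq_trans Nn (leqnSn _)).
have hp := prime_count_ln_ge (ltn0Sn n).
have hu := @ln_succ_sub R n.
have h2 := @ln2_ge R.
have {}n1000 : 1000 <= n.+1%:R :> R by rewrite ler_nat.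
rewrite mulrAC.
have -> : 59 / 100 = 59 / 100 * n.+2%:R * n.+2%:R^-1 :> R by rewrite mulfK ?pnatr_eq0.
apply: ler_pM => //; rewrite (le_trans _ hp)//.
have := ler_wpM2l (ler0n R n.+1) h2.
by rewrite -(natr1 n.+1) in hl *; lra.
Qed.

(** Induction from the threshold [N] of [log_defect_step]: as [ln] increases, the product grows by
    at least [59 / 100] at each step. *)
Lemma log_defect_ln_ge : \forall n \near \oo,
  29 / 50 * n%:R <= log_defect n * ln n%:R.
Proof.
have [N _ HN] := log_defect_step.
have lnS (n : nat) : 0 <= (ln n%:R : R) <= ln n.+1%:R.
  case: n => [|n]; first by rewrite ln0// ln1 lexx.
  by rewrite ln_ge0 ?ler1n//= ler_ln ?posrE ?ltr0n// ler_nat.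
have H (j : nat) : 59 / 100 * j%:R <= log_defect (N + j) * ln (N + j)%:R.
  elim: j => [|j IH].
    by rewrite mulr0 mulr_ge0 ?log_defect_ge0//; case/andP: (lnS (N + 0)%N).
  have := HN (N + j)%N (leq_addr _ _); rewrite /= addnS log_defectS -natr1 => h.
  set S := log_defect _ + _.
  have S0 : 0 <= S by rewrite /S -log_defectS log_defect_ge0.
  have /andP[_ lS] := lnS (N + j)%N.
  by rewrite (le_trans _ (ler_wpM2l S0 lS))// /S; lra.
(* The inequality [59 * (n - N) >= 58 * n] holds as soon as [n >= 59 * N]. *)
exists (59 * N)%N => // n /= Nn.
have nN : (N <= n)%N by rewrite (leq_trans _ Nn)// leq_pmull.
have := H (n - N)%N; rewrite subnKC// natrB//; apply: le_trans.
by move: Nn => /=; rewrite -(ler_nat R) natrM; lra.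
Qed.

Lemma prime_count_ge : \forall n \near \oo,
  59 / 100 * n%:R <= (prime_count n)%:R * ln n%:R :> R.
Proof.
have c0 : 0 < 1 / 200 :> R by rewrite divr_gt0.
have [N _ HN] := near_pinfty_nat (ln_lt_mul c0).
exists (maxn N 1000) => // n /=; rewrite geq_max => /andP[Nn n1000].
have /= hl := HN n.+1 (leq_trans Nn (leqnSn _)).
have hp := @prime_count_ln_ge n ltac:(lia).
have h2 := ler_wpM2l (ler0n R n) (@ln2_ge R).
move: n1000; rewrite -(ler_nat R) => n1000; rewrite (le_trans _ hp)//.
by rewrite -natr1 in hl *; lra.
Qed.

(* With [y], [l], [p], [S], [t] standing for [n], [ln n], [prime_count n],
   [log_defect n], [theta n], the claim times [l] reads
   [t (l - ln t) <= (S - 3 l) ln t]: the left-hand side is at most [y / 2], while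
   [S l >= 29 / 50 y] and [ln t >= 9 / 10 l]. *)
Lemma theta_le : \forall n \near \oo,
  1 <= theta n /\ theta n <= ((prime_count n)%:R - 3) * ln (theta n).
Proof.
have c1 : 0 < 1 / 20 :> R by rewrite divr_gt0.
have c2 : 0 < 1 / 200 :> R by rewrite divr_gt0.
near=> n.
have n3 : (3 <= n)%N by near: n; exact: nbhs_infty_ge.
have y0 : 0 < n%:R :> R by rewrite ltr0n (leq_trans _ n3).
have hp : 59 / 100 * n%:R <= (prime_count n)%:R * ln n%:R :> R.
  by near: n; exact: prime_count_ge.
have hS : 29 / 50 * n%:R <= log_defect n * ln n%:R.
  by near: n; exact: log_defect_ln_ge.
have hll : ln (ln n%:R) <= 1 / 20 * ln n%:R :> R.
  by near: n; exact: near_pinfty_nat (near_pinfty_ln (ln_lt_mul c1)).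
have l40 : 40 <= ln n%:R :> R.
  by near: n; exact: near_pinfty_nat (near_ln_ge _).
have hl2 : ln n%:R ^+ 2 <= 1 / 200 * n%:R :> R.
  by near: n; exact: near_pinfty_nat (sqr_ln_lt_mul c2).
have hSE : (prime_count n)%:R * ln n%:R = theta n + log_defect n by rewrite addrC subrK.
set y := n%:R in y0 hp hS hll hl2 hSE l40 *.
set l := ln y in hp hS hll hl2 hSE l40 *.
set p := (prime_count n)%:R in hp hSE *; set S := log_defect n in hS hSE *.
have ht : p * (3 / 5) <= theta n.
  rewrite (le_trans (ler_wpM2l (ler0n _ _) (@ln2_ge R)))//.
  rewrite mulr_natl -lnXn// ler_ln ?posrE ?exprn_gt0// ?ltr0n ?primorial_gt0//.
  by rewrite -natrX ler_nat exp2_le_primorial.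
set t := theta n in hSE ht *.
have l0 : 0 < l by lra.
have hty : y / (4 * l) <= t.
  by rewrite ler_pdivrMr ?mulr_gt0//; have := ler_wpM2r (ltW l0) ht; lra.
have t0 : 0 < t by rewrite (lt_le_trans _ hty)// divr_gt0// mulr_gt0.
(* Taking logarithms in [hty] loses [ln 4 <= 2] and [ln l <= l / 20], together at most [l / 10]
   because [40 <= l]. *)
have hlam : 9 / 10 * l <= ln t.
  have : ln (y / (4 * l)) <= ln t by rewrite ler_ln ?posrE// divr_gt0// mulr_gt0.
  rewrite ln_div ?posrE ?mulr_gt0// lnM ?posrE// -/l.
  have := @ln_half R 4 ltac:(by []); lra.
split; first by rewrite -ler_ln ?posrE// ln1 (le_trans _ hlam)// mulr_ge0// ltW.
rewrite -(ler_pM2r l0).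
have -> : (p - 3) * ln t * l = (t + S - 3 * l) * ln t by rewrite -hSE; ring.
have hS3 : 0 <= S - 3 * l by rewrite -(pmulr_lge0 _ l0); lra.
(* If [l <= ln t], then [t * (l - ln t)] is nonpositive and [hS3] concludes. *)
have [ll|/ltW ll] := leP l (ln t).
  have := ler_wpM2l (ltW t0) ll; have := mulr_ge0 hS3 (ltW (lt_le_trans l0 ll)).
  lra.
have h1 : t * (l - ln t) <= y / 2.
  have := @ln_half R (y / t) (divr_gt0 y0 t0); rewrite ln_div ?posrE// => h.
  have := ler_wpM2l (ltW t0) h.
  by have -> : t * (y / t / 2) = y / 2 by field; rewrite gt_eqF.
(* The right-hand side is at least [9 / 10 * (29 / 50 - 3 / 200) * y = 0.5085 * y], just above
   [y / 2]. *)
have h2 := ler_wpM2l hS3 hlam.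
lra.
Unshelve. all: by end_near. Qed.

Lemma primorial_unbounded m : exists n, (m < primorial n)%N.
Proof.
have [p mp pp] := prime_above m; exists p; case: p mp pp => // p mp pp.
by rewrite primorialS pp (leq_trans mp)// leq_pmulr// primorial_gt0.
Qed.

Lemma primorial_nondecreasing : {homo primorial : m n / (m <= n)%N}.
Proof.
apply: (homo_leq leqnn leq_trans) => n.
by rewrite primorialS leq_pmull//; case: ifP.
Qed.

(** Choose [n] with [primorial n <= x < primorial n.+1] and apply [theta_le] at [n.+1], where
    [ln x <= theta n.+1]. Passing back to [n] loses at most one prime, which turns the [3] of
    [theta_le] into [2]. *)
Lemma primorial_many_primes : \forall x \near +oo, exists n,
  (primorial n)%:R <= x /\ ln x / ln (ln x) + 2 <= (prime_count n)%:R :> R.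
Proof.
have [N _ HN] := theta_le.
near=> x.
have x1 : 1 <= x by near: x; apply: nbhs_pinfty_ge; rewrite num_real.
have x0 : 0 < x by rewrite (lt_le_trans _ x1).
have xN : (primorial N)%:R <= x.
  by near: x; apply: nbhs_pinfty_ge; rewrite num_real.
have lx : expR 1 <= ln x by near: x; exact: near_ln_ge.
have ex : exists n, x < (primorial n)%:R.
  have [n hn] := primorial_unbounded (Num.bound x); exists n.
  rewrite (lt_trans (archi_boundP (ltW x0)))// ltr_nat//.
have [[|n] xn nmin] := @ex_minnP _ ex.
  by move: xn; rewrite primorial0 ltNge x1.
exists n; split; first by rewrite leNgt; apply/negP => /nmin; rewrite ltnn.
have Nn : (N <= n.+1)%N.
  rewrite leqNgt; apply/negP => nN; move: xN; apply/negP; rewrite -ltNge.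
  by rewrite (lt_le_trans xn)// ler_nat primorial_nondecreasing// ltnW.
have [t1 ht] := HN n.+1 Nn.
have xt : ln x <= theta n.+1.
  by rewrite ler_ln ?posrE// ?ltr0n ?primorial_gt0// ltW.
have lt0 : 0 < ln (theta n.+1).
  rewrite (lt_le_trans (ltr01 : 0 < 1 :> R))// -ler_expR lnK ?posrE ?(lt_le_trans _ t1)//.
  exact: le_trans xt.
have := div_ln_nondecreasing lx xt.
move=> h; rewrite -lerBrDr (le_trans h)// ler_pdivrMr// (le_trans ht)//.
rewrite ler_wpM2r ?(ltW lt0)// prime_countS natrD.
have : (prime n.+1)%:R <= 1 :> R by case: prime.
lra.
Unshelve. all: by end_near. Qed.

End chebyshev.

(** * Dirichlet convolution *)

Section dirichlet_convolution.
Context {A : comNzRingType}.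
Implicit Types f h w : nat -> A.

Definition dconv f h n : A := \sum_(1 <= d < n.+1 | (d %| n)%N) f d * h (n %/ d)%N.

Fixpoint dpow f m : nat -> A :=
  if m is m'.+1 then dconv f (dpow f m') else fun n => (n == 1)%:R.

(** The weight [w] will be [n ^ (- s)] in the complex numbers or its modulus in the reals, hence the
    arbitrary ring. *)
Definition psum f w N : A := \sum_(1 <= n < N.+1) f n * w n.

Lemma sum_multiples (V : nmodType) (F : nat -> V) d N : (0 < d)%N ->
  \sum_(1 <= n < N.+1 | (d %| n)%N) F n =
  \sum_(1 <= e < (N %/ d).+1) F (d * e)%N.
Proof.
move=> d0; elim: N => [|N IH]; first by rewrite div0n !big_geq.
rewrite big_mkcond big_nat_recr//= -big_mkcond/= IH divnS//.
case: ifPn => dN; last by rewrite addr0.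
rewrite add1n [RHS]big_nat_recr//=; congr (_ + F _).
by have := divnK dN; rewrite divnS// dN mulnC add1n.
Qed.

(** The pairs [d], [e] with [d * e <= N] are grouped by [d], and complete multiplicativity of [w]
    splits each term. *)
Lemma psum_dconv f h w N :
  (forall d e, (0 < d)%N -> (0 < e)%N -> w (d * e)%N = w d * w e) ->
  psum (dconv f h) w N =
  \sum_(1 <= d < N.+1) f d * w d * psum h w (N %/ d).
Proof.
move=> wM; rewrite /psum /dconv.
(* Widening the inner range to [N] makes it independent of [n], so that the sums can be exchanged;
   no [d > n] divides a positive [n]. *)
transitivity (\sum_(1 <= n < N.+1) \sum_(1 <= d < N.+1 | (d %| n)%N)
    f d * h (n %/ d)%N * w n).
  apply: eq_big_nat => n /andP[n0 nN]; rewrite big_distrl/=.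
  rewrite [RHS](big_cat_nat (n := n.+1))//= [X in _ + X]big1_seq ?addr0//.
  move=> d; rewrite mem_index_iota => /andP[dn /andP[nd _]].
  by move: (dvdn_leq n0 dn); rewrite leqNgt nd.
rewrite (exchange_big_dep_nat xpredT)//=; apply: eq_big_nat => d /andP[d0 _].
rewrite sum_multiples// big_distrr/=; apply: eq_big_nat => e /andP[e0 _].
by rewrite mulKn// wM// mulrACA.
Qed.

Lemma psum_unit w N : w 1%N = 1 -> (0 < N)%N ->
  psum (fun n => (n == 1)%:R) w N = 1.
Proof.
move=> w1 N0; rewrite /psum big_ltn// mul1r w1 big1_seq ?addr0// => n.
rewrite mem_index_iota => /andP[_ /andP[n1 _]].
by rewrite gtn_eqF// mul0r.
Qed.

End dirichlet_convolution.

(** * Lower bounds for convolution powers at primorials *)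

Section nonneg_convolution.
Context {R : realType}.
Implicit Types f h w : nat -> R.

Lemma dconv_ge0 f h n : (forall d, (0 < d)%N -> 0 <= f d) ->
  (forall d, (0 < d)%N -> 0 <= h d) -> 0 <= dconv f h n.
Proof.
move=> f0 h0; rewrite /dconv big_seq_cond sumr_ge0// => d.
rewrite mem_index_iota ltnS => /andP[/andP[d0 dn] _].
by rewrite mulr_ge0 ?f0 ?h0// divn_gt0.
Qed.

Lemma dpow_ge0 f m n : (forall d, (0 < d)%N -> 0 <= f d) -> 0 <= dpow f m n.
Proof.
move=> f0; elim: m n => [|m IH] n; first by rewrite ler0n.
by apply: dconv_ge0.
Qed.

Lemma le_dpow f h m n : (0 < n)%N -> (forall d, (0 < d)%N -> 0 <= f d <= h d) ->
  dpow f m n <= dpow h m n.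
Proof.
move=> + fh; elim: m n => [//|m IH] n n0.
rewrite /= /dconv big_seq_cond [leRHS]big_seq_cond ler_sum// => d.
rewrite mem_index_iota ltnS => /andP[/andP[d0 dn] _].
have /andP[fd0 fhd] := fh d d0; rewrite ler_pM// ?IH ?divn_gt0//.
by apply: dpow_ge0 => e /fh/andP[].
Qed.

Lemma dpow_at1 f m : f 1%N = 1 -> dpow f m 1 = 1.
Proof.
move=> f1; elim: m => [//|m IH].
by rewrite /= /dconv big_mkcond big_nat1/= divn1 IH f1 mulr1.
Qed.

(* The divisors of [n * p] split into the divisors [d] of [n] and the products
   [d * p]. *)
Lemma dpow1_mul_prime m n p : (0 < n)%N -> prime p -> ~~ (p %| n)%N ->
  m%:R * dpow (fun=> 1 : R) m n <= dpow (fun=> 1) m (n * p).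
Proof.
move=> + pp; elim: m n => [|m IH] n n0 pn; first by rewrite mul0r ler0n.
set u := dpow _ m in IH *; have p0 := prime_gt0 pp.
have u0 e : 0 <= u e by apply: dpow_ge0.
(* The divisors that are multiples of [p] give one copy of the coefficient at [n]. *)
have Hp : \sum_(1 <= d < (n * p).+1 | (d %| n * p)%N && (p %| d)%N)
    u (n * p %/ d)%N = \sum_(1 <= d < n.+1 | (d %| n)%N) u (n %/ d)%N.
  rewrite (eq_bigl _ _ (fun d => andbC _ _)) big_mkcondr/=.
  rewrite (sum_multiples (fun d => if (d %| n * p)%N then u (n * p %/ d)%N else 0))//.
  rewrite mulnK// [RHS]big_mkcond; apply: eq_bigr => d _.
  by rewrite mulnC dvdn_pmul2r// divnMr.
(* The divisors prime to [p] give at least [m] further copies, by induction at [n %/ d]. *)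
have Hq : m%:R * \sum_(1 <= d < n.+1 | (d %| n)%N) u (n %/ d)%N <=
    \sum_(1 <= d < (n * p).+1 | (d %| n * p)%N && ~~ (p %| d)%N) u (n * p %/ d)%N.
  rewrite [leRHS](big_cat_nat (n := n.+1))//= ?ltnS ?leq_pmulr//.
  rewrite ler_wpDr ?sumr_ge0// big_distrr/= big_mkcond [leRHS]big_mkcond/=.
  rewrite big_nat_cond [leRHS]big_nat_cond ler_sum// => d /andP[/andP[d0 dn] _].
  case: ifPn => [dvn|_]; last by case: ifP.
  have pd : ~~ (p %| d)%N by apply: contra pn => /dvdn_trans; apply.
  rewrite dvdn_mulr//= pd -divn_mulAC// IH ?divn_gt0//.
  by apply: contra pn => pnd; rewrite -(divnK dvn) dvdn_mulr.
rewrite /= /dconv; under eq_bigr do rewrite mul1r.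
under [leRHS]eq_bigr do rewrite mul1r.
rewrite [leRHS](bigID (fun d => p %| d)%N)/= Hp -natr1 mulrDl mul1r.
by rewrite [leLHS]addrC lerD2l.
Qed.

Lemma prime_gt_ndvd_primorial p n : prime p -> (n < p)%N -> ~~ (p %| primorial n)%N.
Proof.
move=> pp; elim: n => [|n IH] np.
  by rewrite primorial0 dvdn1 gtn_eqF// prime_gt1.
rewrite primorialS Euclid_dvdM// negb_or IH ?(ltnW np)// andbT.
by case: ifP => _; rewrite ?dvdn1 ?gtn_eqF ?prime_gt1// gtnNdvd.
Qed.

(** By [le_dpow] it is enough to treat the constant function [1], for which each new prime
    multiplies the coefficient by at least [m]. *)
Lemma dpow_primorial f m n : (forall d, (0 < d)%N -> 1 <= f d) ->
  m%:R ^+ prime_count n <= dpow f m (primorial n).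
Proof.
move=> f1.
have f01 d : (0 < d)%N -> 0 <= (1 : R) <= f d by move=> d0; rewrite ler01 f1.
apply: (le_trans _ (le_dpow m (primorial_gt0 n) f01)).
elim: n => [|n IH]; first by rewrite prime_count0 primorial0 dpow_at1.
rewrite prime_countS primorialS; case: ifPn => [pn|_]; last by rewrite addn0 mul1n.
rewrite addn1 exprS mulnC.
have pP := prime_gt_ndvd_primorial pn (ltnSn n).
apply: le_trans (dpow1_mul_prime _ (primorial_gt0 n) pn pP).
by rewrite ler_wpM2l.
Qed.

End nonneg_convolution.

(** * Majorized complex series *)

Section complex_series.
Context {R : realType}.
Implicit Types (z : R[i]) (f : nat -> R[i]).

Local Notation normc := (@Normc.normc R).

Lemma normr_normc z : `|z| = (normc z)%:C. Proof. by case: z. Qed.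

Lemma normcD z1 z2 : normc (z1 + z2) <= normc z1 + normc z2.
Proof. exact: le_normcD. Qed.

Lemma normcB z1 z2 : normc (z1 - z2) = normc (z2 - z1).
Proof. by rewrite -[LHS]normcN opprB. Qed.

Lemma normc_ge0 z : 0 <= normc z.
Proof. by case: z => a b; exact: sqrtr_ge0. Qed.

Lemma normcX z n : normc (z ^+ n) = normc z ^+ n.
Proof.
by elim: n => [|n IH]; rewrite ?Normc.normc1// !exprS Normc.normcM IH.
Qed.

Lemma normc_real (x : R) : 0 <= x -> normc x%:C = x.
Proof. by move=> x0; rewrite /= expr0n/= addr0 sqrtr_sqr ger0_norm. Qed.

Lemma le_normc_sum (I : Type) (r : seq I) (P : pred I) (F : I -> R[i]) :
  normc (\sum_(i <- r | P i) F i) <= \sum_(i <- r | P i) normc (F i).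
Proof.
elim/big_ind2 : _ => [|x X y Y hx hy|//]; first by rewrite Normc.normc0.
by rewrite (le_trans (normcD _ _))// lerD.
Qed.

Lemma le_Re_normc z : `|complex.Re z| <= normc z.
Proof. by rewrite -lecR -normr_normc normc_ge_Re. Qed.

Lemma le_Im_normc z : `|complex.Im z| <= normc z.
Proof.
case: z => a b /=; rewrite -sqrtr_sqr ler_wsqrtr// lerDr sqr_ge0//.
Qed.

Lemma le_normc_ReIm z : normc z <= `|complex.Re z| + `|complex.Im z|.
Proof.
case: z => a b /=.
rewrite -[leRHS]ger0_norm ?addr_ge0// -sqrtr_sqr ler_wsqrtr//.
rewrite sqrrD !real_normK ?num_real//.
by rewrite -addrA lerD2l lerDr mulrn_wge0// mulr_ge0.
Qed.

Lemma cvg_cplx (u : nat -> cplx R) (l : R[i]) (v : nat -> R) :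
  (forall n, normc (l - u n) <= v n) -> v @ \oo --> 0 -> u @ \oo --> (l : cplx R).
Proof.
move=> uv v0; apply/cvgrPdist_le => /= e.
(* The radius [e] is a complex number; [0 < e] forces its imaginary part to vanish. *)
rewrite ltcE/= => /andP[/eqP e1 e0].
have -> : e = (complex.Re e)%:C by case: e e1 {e0} => a b /= ->.
have /cvgrPdist_le/(_ _ e0) := v0; apply: filterS => n.
rewrite sub0r normrN => h.
have -> : `|(l : cplx R) - u n| = (normc (l - u n))%:C by rewrite -normr_normc.
by rewrite lecR (le_trans (uv n))// (le_trans (ler_norm _)).
Qed.

(** Comparison with [b] makes the real and imaginary parts converge absolutely, which produces the
    limit [l]. *)
Lemma dominated_series f (b : nat -> R) (B : R) :
  (forall n, normc (f n) <= b n) -> series b @ \oo --> B ->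
  exists l, forall n, normc (l - \sum_(0 <= i < n) f i) <= B - series b n.
Proof.
move=> fb bB.
have b0 n : 0 <= b n by rewrite (le_trans _ (fb n))// normc_ge0.
have cv (p : R[i] -> R) : (forall z, `|p z| <= normc z) ->
    cvgn (series (p \o f)).
  move=> pn; apply: (@normed_cvg R R^o).
  apply: (@series_le_cvg _ _ b) => //= [n|]; last exact: cvgP bB.
  exact: le_trans (pn _) (fb n).
have /cvg_ex[x hx] := cv _ le_Re_normc.
have /cvg_ex[y hy] := cv _ le_Im_normc.
have ReE n : series (@complex.Re R \o f) n = complex.Re (\sum_(0 <= i < n) f i).
  by rewrite /series/=; elim/big_ind2 : _ => // -[a1 b1] c [a2 b2] d /= -> ->.
have ImE n : series (@complex.Im R \o f) n = complex.Im (\sum_(0 <= i < n) f i).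
  by rewrite /series/=; elim/big_ind2 : _ => // -[a1 b1] c [a2 b2] d /= -> ->.
exists (x +i* y) => K; set s := fun n => \sum_(0 <= i < n) f i.
(* For [n >= K] this expression bounds the distance from the limit to the sum at [K], by the
   triangle inequality through the sum at [n]; then [n] tends to infinity. *)
have lim : `|x - series (@complex.Re R \o f) n| + `|y - series (@complex.Im R \o f) n| +
    (series b n - series b K) @[n --> \oo] --> `|x - x| + `|y - y| + (B - series b K).
  apply: cvgD; last by apply: cvgB => //; exact: cvg_cst.
  by apply: cvgD; apply: cvg_norm; apply: cvgB => //; exact: cvg_cst.
rewrite !subrr normr0 !add0r in lim.
apply: (cvgr_to_ge lim); exists K => //= n Kn.
have -> : x +i* y - s K = (x +i* y - s n) + (s n - s K) by rewrite addrA subrK.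
rewrite (le_trans (normcD _ _))// lerD//.
  rewrite (le_trans (le_normc_ReIm _))// ReE ImE -/(s n).
  by case: (s n).
rewrite /s /series/= !(big_cat_nat (m := 0) (n := K) (p := n))//=.
rewrite ![_ + _ - _]addrAC !subrr !add0r (le_trans (le_normc_sum _ _ _))//.
by apply: ler_sum.
Qed.

End complex_series.

(** * Products and superpositions of majorized Dirichlet series *)

Section majorized_dirichlet_series.
Context {R : realType} (w : nat -> R[i]) (W : nat -> R).
Hypothesis W_ge0 : forall n, 0 <= W n.
Hypothesis normc_w : forall n, Normc.normc (w n) = W n.
Hypothesis w1 : w 1 = 1.
Hypothesis wM : forall d e, (0 < d)%N -> (0 < e)%N -> w (d * e)%N = w d * w e.
Implicit Types f h : nat -> R.

Local Notation normc := (@Normc.normc R).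
Local Notation toC f := (fun n => (f n)%:C).

Lemma W1 : W 1 = 1.
Proof. by rewrite -normc_w w1 Normc.normc1. Qed.

Lemma WM d e : (0 < d)%N -> (0 < e)%N -> W (d * e)%N = W d * W e.
Proof. by move=> d0 e0; rewrite -!normc_w wM// Normc.normcM. Qed.

(* [z] is the value of the Dirichlet series at the complex character [w], and its
   tails are bounded by those of the series at the modulus [W] of [w]. *)
Definition majorized f z Z := psum f W @ \oo --> Z /\
  forall N, normc (z - psum (toC f) w N) <= Z - psum f W N.

Lemma psumS (A : comNzRingType) (f v : nat -> A) N :
  psum f v N.+1 = psum f v N + f N.+1 * v N.+1.
Proof. by rewrite /psum big_nat_recr. Qed.

Lemma psum_ge0 f N : (forall d, (0 < d)%N -> 0 <= f d) -> 0 <= psum f W N.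
Proof.
move=> f0; rewrite /psum big_nat_cond sumr_ge0// => d /andP[/andP[d0 _] _].
by rewrite mulr_ge0 ?f0.
Qed.

Lemma le_psum f : (forall d, (0 < d)%N -> 0 <= f d) ->
  {homo psum f W : m n / (m <= n)%N >-> m <= n}.
Proof.
move=> f0; apply: homo_leq => [//|??? /le_trans|n]; first exact.
by rewrite psumS lerDl mulr_ge0 ?f0.
Qed.

Lemma majorized_le f z Z N : majorized f z Z -> psum f W N <= Z.
Proof. by move=> [_ /(_ N)] h; rewrite -subr_ge0 (le_trans _ h)// normc_ge0. Qed.

Lemma majorized_norm f z Z : majorized f z Z -> normc z <= Z.
Proof. by move=> [_ /(_ 0%N)]; rewrite /psum !big_geq// !subr0. Qed.

Lemma cvg_psum_le f B : (forall d, (0 < d)%N -> 0 <= f d) ->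
  (forall N, psum f W N <= B) -> cvgn (psum f W).
Proof.
move=> f0 fB; apply: nondecreasing_is_cvgn; first exact: le_psum.
by exists B => _ [n _ <-].
Qed.

Lemma normc_term f n : 0 <= f n -> normc ((f n)%:C * w n) = f n * W n.
Proof. by move=> f0; rewrite Normc.normcM normc_w normc_real. Qed.

Lemma majorized_ex f Z : (forall d, (0 < d)%N -> 0 <= f d) ->
  psum f W @ \oo --> Z -> exists z, majorized f z Z.
Proof.
move=> f0 fZ.
have shift (A : comNzRingType) (u v : nat -> A) N :
    psum u v N = \sum_(0 <= n < N) u n.+1 * v n.+1.
  by rewrite /psum big_add1.
have [] := @dominated_series R (fun n => (f n.+1)%:C * w n.+1)
  (fun n => f n.+1 * W n.+1) Z.
- by move=> n; rewrite normc_term// f0.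
- by apply: cvg_trans fZ; apply: near_eq_cvg; near=> n; rewrite shift.
move=> z hz; exists z; split => // N.
by rewrite !shift; exact: hz.
Unshelve. all: by end_near. Qed.

Lemma majorized_unit : majorized (fun n => (n == 1)%:R) 1 1.
Proof.
have E : toC (fun n : nat => (n == 1)%:R : R) = fun n => (n == 1)%:R :> R[i].
  by apply/funext => n; rewrite rmorph_nat.
split=> [|[|N]].
- apply: cvg_near_cst; exists 1 => // N /= N1.
  by rewrite psum_unit// W1.
- by rewrite /psum !big_geq// !subr0 Normc.normc1.
- by rewrite E !psum_unit ?W1// !subrr Normc.normc0.
Qed.

Lemma psum_dconv_le f h B C : (forall d, (0 < d)%N -> 0 <= f d) ->
  (forall d, (0 < d)%N -> 0 <= h d) ->
  (forall N, psum f W N <= B) -> (forall N, psum h W N <= C) ->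
  forall N, psum (dconv f h) W N <= B * C.
Proof.
move=> f0 h0 fB hC N; rewrite psum_dconv; last exact: WM.
have C0 : 0 <= C by rewrite (le_trans _ (hC 0%N))// psum_ge0.
apply: le_trans (ler_wpM2r C0 (fB N)).
rewrite [psum f W N]/psum big_distrl/= big_nat_cond [leRHS]big_nat_cond ler_sum// => d.
by move=> /andP[/andP[d0 _] _]; rewrite ler_wpM2l// mulr_ge0 ?f0.
Qed.

(** The rectangle [d <= D], [e <= E] lies in the region [d * e <= D * E]. Together with
    [psum_dconv_le] this squeezes the limit for a convolution. *)
Lemma psum_dconv_ge f h D E : (forall d, (0 < d)%N -> 0 <= f d) ->
  (forall d, (0 < d)%N -> 0 <= h d) ->
  psum f W D * psum h W E <= psum (dconv f h) W (D * E)%N.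
Proof.
move=> f0 h0.
have [->|E0] := posnP E.
  by rewrite muln0 /psum [X in _ * X]big_geq// mulr0 big_geq.
rewrite psum_dconv; last exact: WM.
rewrite [leRHS](big_cat_nat (n := D.+1))//= ?ltnS ?leq_pmulr//.
rewrite ler_wpDr//.
  rewrite big_nat_cond sumr_ge0// => d /andP[/andP[d0 _] _].
  by rewrite mulr_ge0 ?psum_ge0// mulr_ge0 ?f0// (leq_ltn_trans _ d0).
rewrite [psum f W D]/psum big_distrl/= big_nat_cond [leRHS]big_nat_cond ler_sum// => d.
move=> /andP[/andP[d0 dD] _]; rewrite ler_wpM2l ?mulr_ge0 ?f0// le_psum//.
by rewrite leq_divRL// mulnC leq_mul.
Qed.

Lemma real_complex_dconv f h : toC (dconv f h) = dconv (toC f) (toC h).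
Proof.
apply/funext => n; rewrite /dconv rmorph_sum; apply: eq_bigr => d _.
by rewrite rmorphM.
Qed.

Lemma majorized_dconv f h zf zh Zf Zh : (forall d, (0 < d)%N -> 0 <= f d) ->
  (forall d, (0 < d)%N -> 0 <= h d) ->
  majorized f zf Zf -> majorized h zh Zh ->
  majorized (dconv f h) (zf * zh) (Zf * Zh).
Proof.
move=> f0 h0 mf mh; have [fZ fz] := mf; have [hZ hz] := mh.
have fh0 d : (0 < d)%N -> 0 <= dconv f h d by move=> _; exact: dconv_ge0.
have ub := psum_dconv_le f0 h0 (fun N => majorized_le N mf) (fun N => majorized_le N mh).
split.
  have cv := cvg_psum_le fh0 ub.
  suff <- : limn (psum (dconv f h) W) = Zf * Zh by [].
  apply/eqP; rewrite eq_le; apply/andP; split.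
    by apply: limr_le => //; near=> N; exact: ub.
  have hfZ : psum f W n * psum h W n @[n --> \oo] --> Zf * Zh by apply: cvgM.
  apply: (cvgr_to_le hfZ); near=> N.
  apply: le_trans (psum_dconv_ge _ _ f0 h0) _.
  by apply: nondecreasing_cvgn_le => //; exact: le_psum.
move=> N; rewrite real_complex_dconv !psum_dconv//; last exact: WM.
(* The error splits into the tails of [h] weighted by [f] and the tail of [f] times [zh]. The same
   splitting at [W] then dominates it term by term. *)
have -> : zf * zh - \sum_(1 <= d < N.+1) (f d)%:C * w d * psum (toC h) w (N %/ d) =
    \sum_(1 <= d < N.+1) (f d)%:C * w d * (zh - psum (toC h) w (N %/ d)) +
    (zf - psum (toC f) w N) * zh.
  under [X in _ = X + _]eq_bigr do rewrite mulrBr.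
  by rewrite sumrB -mulr_suml -/(psum (toC f) w N); ring.
have -> : Zf * Zh - \sum_(1 <= d < N.+1) f d * W d * psum h W (N %/ d) =
    \sum_(1 <= d < N.+1) f d * W d * (Zh - psum h W (N %/ d)) +
    (Zf - psum f W N) * Zh.
  under [X in _ = X + _]eq_bigr do rewrite mulrBr.
  by rewrite sumrB -mulr_suml -/(psum f W N); ring.
rewrite (le_trans (normcD _ _))// lerD//.
  rewrite (le_trans (le_normc_sum _ _ _))// big_nat_cond [leRHS]big_nat_cond.
  apply: ler_sum => d /andP[/andP[d0 _] _].
  by rewrite Normc.normcM normc_term ?f0// ler_wpM2l ?mulr_ge0 ?f0.
by rewrite Normc.normcM ler_pM ?normc_ge0// (majorized_norm mh).
Unshelve. all: by end_near. Qed.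

Lemma majorized_dpow f z Z m : (forall d, (0 < d)%N -> 0 <= f d) ->
  majorized f z Z -> majorized (dpow f m) (z ^+ m) (Z ^+ m).
Proof.
move=> f0 mf; elim: m => [|m IH]; first by rewrite !expr0; exact: majorized_unit.
by rewrite !exprS; apply: majorized_dconv => // d _; exact: dpow_ge0.
Qed.

Lemma cvg_psum (v : nat -> nat -> R) (a : nat -> R) N :
  (forall n, (0 < n)%N -> v K n @[K --> \oo] --> a n) ->
  psum (v K) W N @[K --> \oo] --> psum a W N.
Proof.
move=> va; elim: N => [|N IH].
  rewrite /psum big_geq//.
  by under eq_fun do rewrite big_geq//; exact: cvg_cst.
rewrite psumS; under eq_fun do rewrite psumS.
by apply: cvgD => //; apply: cvgM; [exact: va|exact: cvg_cst].
Qed.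

Lemma psum_series (A : comNzRingType) (c : nat -> A) (f : nat -> nat -> A) v K N :
  psum (fun n => \sum_(0 <= m < K) c m * f m n) v N =
  \sum_(0 <= m < K) c m * psum (f m) v N.
Proof.
rewrite /psum; under eq_bigr do rewrite big_distrl/=.
rewrite exchange_big/=; apply: eq_bigr => m _.
by rewrite big_distrr/=; apply: eq_bigr => n _; rewrite mulrA.
Qed.

(** Sums over [m] and [n] are interchanged: at [W] all terms are nonnegative and this is monotone
    convergence, while the complex tails follow by comparison. *)
Lemma majorized_series (c : nat -> R) (f : nat -> nat -> R) (a : nat -> R)
    (z : nat -> R[i]) (Z : nat -> R) zz ZZ :
  (forall m, 0 <= c m) -> (forall m d, (0 < d)%N -> 0 <= f m d) ->
  (forall m, majorized (f m) (z m) (Z m)) ->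
  series (fun m => c m * Z m) @ \oo --> ZZ ->
  (forall K, normc (zz - \sum_(0 <= m < K) (c m)%:C * z m) <=
             ZZ - series (fun m => c m * Z m) K) ->
  (forall n, (0 < n)%N -> series (fun m => c m * f m n) @ \oo --> a n) ->
  majorized a zz ZZ.
Proof.
move=> c0 f0 mf cZ czz ca.
pose S K n := series (fun m => c m * f m n) K.
have S0 K n : (0 < n)%N -> 0 <= S K n.
  by move=> n0; rewrite /S /series/= sumr_ge0// => m _; rewrite mulr_ge0 ?f0.
have Snd n : (0 < n)%N -> {homo (S ^~ n) : K L / (K <= L)%N >-> K <= L}.
  by move=> n0; apply: nondecreasing_series => m _ _; rewrite mulr_ge0 ?f0.
have Sa K n : (0 < n)%N -> S K n <= a n.
  move=> n0; rewrite -(cvg_lim (@Rhausdorff R) (ca n n0)).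
  by apply: (nondecreasing_cvgn_le (Snd n n0)); exact: cvgP (ca n n0).
have a0 n : (0 < n)%N -> 0 <= a n by move=> n0; rewrite (le_trans _ (Sa 0%N n n0))// S0.
have SE K N : psum (S K) W N = \sum_(0 <= m < K) c m * psum (f m) W N.
  exact: psum_series.
have cvS N : psum (S K) W N @[K --> \oo] --> psum a W N by apply: cvg_psum.
have cZnd : {homo series (fun m => c m * Z m) : K L / (K <= L)%N >-> K <= L}.
  apply: nondecreasing_series => m _ _; rewrite mulr_ge0//.
  by rewrite (le_trans _ (majorized_norm (mf m)))// normc_ge0.
have cZle K : series (fun m => c m * Z m) K <= ZZ.
  rewrite -(cvg_lim (@Rhausdorff R) cZ).
  by apply: (nondecreasing_cvgn_le cZnd); exact: cvgP cZ.
have aZ N : psum a W N <= ZZ.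
  apply: (cvgr_to_le (cvS N)); near=> K.
  rewrite SE (le_trans _ (cZle K))//; apply: ler_sum => m _.
  by rewrite ler_wpM2l// (majorized_le _ (mf m)).
have acv := cvg_psum_le a0 aZ.
have cSN K : psum (S K) W N @[N --> \oo] --> series (fun m => c m * Z m) K.
  under eq_fun do rewrite SE; rewrite /series/=; elim: K => [|K IH].
    by rewrite big_geq//; under eq_fun do rewrite big_geq//; exact: cvg_cst.
  rewrite big_nat_recr//= [X in X @ \oo](_ : _ = fun N =>
    \sum_(0 <= m < K) c m * psum (f m) W N + c K * psum (f K) W N); last first.
    by apply/funext => N; rewrite big_nat_recr.
  by apply: cvgD => //; apply: cvgM; [exact: cvg_cst|case: (mf K)].
split.
  suff <- : limn (psum a W) = ZZ by [].
  apply/eqP; rewrite eq_le; apply/andP; split.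
    by apply: limr_le => //; near=> N; exact: aZ.
  (* Each partial sum over [m < K] is the limit in [N] of sums with coefficients [S K <= a]. *)
  apply: (cvgr_to_le cZ); near=> K.
  apply: (cvgr_to_le (cSN K)); near=> N.
  rewrite (le_trans (_ : _ <= psum a W N))//; last first.
    by apply: nondecreasing_cvgn_le => //; exact: le_psum.
  rewrite /psum big_nat_cond [leRHS]big_nat_cond; apply: ler_sum => n.
  by move=> /andP[/andP[n0 _] _]; rewrite ler_wpM2r ?Sa.
move=> N.
(* Three errors add up to this expression: cutting the sum over [m] at [K], cutting each series
   [f m] at [N], and replacing [a] by [S K]. The last two each contribute one [psum (S K) W N]. *)
have lim : ZZ + psum a W N - (psum (S K) W N + psum (S K) W N) @[K --> \oo] -->
    ZZ + psum a W N - (psum a W N + psum a W N).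
  by apply: cvgB; [exact: cvg_cst|exact: cvgD].
have -> : ZZ - psum a W N = ZZ + psum a W N - (psum a W N + psum a W N) by ring.
apply: (cvgr_to_ge lim); near=> K.
have toCS : toC (S K) = fun n => \sum_(0 <= m < K) (c m)%:C * (f m n)%:C.
  apply/funext => n; rewrite /S /series/= rmorph_sum.
  by apply: eq_bigr => m _; rewrite rmorphM.
have -> : zz - psum (toC a) w N = (zz - \sum_(0 <= m < K) (c m)%:C * z m) +
    (\sum_(0 <= m < K) (c m)%:C * (z m - psum (toC (f m)) w N) +
     (psum (toC (S K)) w N - psum (toC a) w N)).
  under [X in _ = _ + (X + _)]eq_bigr do rewrite mulrBr.
  by rewrite sumrB toCS psum_series; ring.
have -> : ZZ + psum a W N - (psum (S K) W N + psum (S K) W N) =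
    (ZZ - series (fun m => c m * Z m) K) +
    (\sum_(0 <= m < K) c m * (Z m - psum (f m) W N) + (psum a W N - psum (S K) W N)).
  under [X in _ = _ + (X + _)]eq_bigr do rewrite mulrBr.
  by rewrite sumrB -SE /series/=; ring.
rewrite (le_trans (normcD _ _))// lerD// (le_trans (normcD _ _))// lerD//.
  rewrite (le_trans (le_normc_sum _ _ _))//; apply: ler_sum => m _.
  by rewrite Normc.normcM normc_real// ler_wpM2l//; case: (mf m).
rewrite /psum -!sumrB (le_trans (le_normc_sum _ _ _))//.
rewrite big_nat_cond [leRHS]big_nat_cond; apply: ler_sum => n /andP[/andP[n0 _] _].
rewrite -!mulrBl -rmorphB Normc.normcM normc_w ler_wpM2r//.
by rewrite -normcN -rmorphN opprB normc_real ?subr_ge0 ?Sa.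
Unshelve. all: by end_near. Qed.

End majorized_dirichlet_series.

(** * The Dirichlet series of [M_F \o g] *)

Section exponential_character.
Context {R : realType}.
Implicit Types s z : R[i].

Local Notation normc := (@Normc.normc R).

(** This is [n ^ (- s)], in the form that it has in [dirichlet_term]. *)
Definition natpow s n : R[i] := cexp (- s * (ln n%:R)%:C).

Lemma cexpD z1 z2 : cexp (z1 + z2) = cexp z1 * cexp z2.
Proof.
case: z1 z2 => [a b] [c d]; rewrite /cexp /=; apply/eqP; rewrite eq_complex /=.
by rewrite expRD cosD sinD; apply/andP; split; apply/eqP; ring.
Qed.

Lemma normc_cexp z : normc (cexp z) = expR (complex.Re z).
Proof.
case: z => a b /=; rewrite !exprMn -mulrDr cos2Dsin2 mulr1 sqrtr_sqr.
by rewrite ger0_norm ?expR_ge0.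
Qed.

Lemma natpow1 s : natpow s 1 = 1.
Proof.
by rewrite /natpow ln1 mulr0 /cexp /= expR0 cos0 sin0 mulr1 mulr0.
Qed.

Lemma natpowM s d e : (0 < d)%N -> (0 < e)%N ->
  natpow s (d * e)%N = natpow s d * natpow s e.
Proof.
by move=> d0 e0; rewrite /natpow natrM lnM ?posrE ?ltr0n// rmorphD mulrDr cexpD.
Qed.

Lemma series_dirichlet_term (a : nat -> R) s N :
  series (dirichlet_term a s) N = psum (fun n => (a n)%:C) (natpow s) N.
Proof. by rewrite /psum big_add1. Qed.

Let W s n : R := normc (natpow s n).

Lemma W_gt0 s n : 0 < W s n.
Proof. by rewrite /W normc_cexp expR_gt0. Qed.

Lemma dirichlet_cvg (a : nat -> R) s z Z : majorized (natpow s) (W s) a z Z ->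
  series (dirichlet_term a s) @ \oo --> (z : cplx R).
Proof.
move=> [aZ az]; apply: (@cvg_cplx _ _ _ (fun N => Z - psum a (W s) N)).
  by move=> N; rewrite series_dirichlet_term.
by rewrite -(subrr Z); apply: cvgB => //; exact: cvg_cst.
Qed.

Lemma cvg_cplx_lim (u : nat -> cplx R) (z : R[i]) :
  u @ \oo --> (z : cplx R) -> limn u = z.
Proof. by move=> /cvg_lim; apply; exact: norm_hausdorff. Qed.

(** The normed series takes values in [R[i]], so the real sum [Z] comes from monotonicity and
    boundedness: the partial sums end up within [1] of the limit [l]. *)
Lemma abs_cvg_majorized (g : nat -> R) s : (forall d, (0 < d)%N -> 0 <= g d) ->
  cvgn [normed series (dirichlet_term g s)] ->
  exists Z, majorized (natpow s) (W s) g (dirichlet g s) Z.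
Proof.
move=> g0 /cvg_ex[/= l hl].
have /cvgrPdist_le/(_ 1 ltr01)[N _ HN] :
  ([normed series (dirichlet_term g s)] : nat -> cplx R) @ \oo --> (l : cplx R) := hl.
have E n : [normed series (dirichlet_term g s)] n = (psum g (W s) n)%:C.
  rewrite /psum big_add1/= rmorph_sum; apply: eq_bigr => i _.
  by rewrite normr_normc Normc.normcM normc_real ?g0.
have HN' n : (N <= n)%N -> `|l - (psum g (W s) n)%:C| <= 1.
  by move=> Nn; rewrite -E; exact: HN.
have ub n : psum g (W s) n <= normc l + 1.
  apply: (@le_trans _ _ (psum g (W s) (maxn N n))).
    by apply: le_psum => //; rewrite ?leq_maxr// => k; exact/ltW/W_gt0.
  have := HN' _ (leq_maxl N n); rewrite normr_normc (_ : 1 = 1%:C)// lecR => h.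
  have p0 : 0 <= psum g (W s) (maxn N n).
    by apply: psum_ge0 => // k; exact/ltW/W_gt0.
  rewrite -{1}(normc_real p0) -(subrK l (_%:C)) (le_trans (normcD _ _))//.
  by rewrite addrC lerD2l normcB.
have := cvg_psum_le (W := W s) (fun k => ltW (W_gt0 s k)) g0 ub.
move=> /cvg_ex[Z hZ]; exists Z.
have [z hz] := majorized_ex (w := natpow s) (fun=> erefl) g0 hZ.
by rewrite /dirichlet (cvg_cplx_lim (dirichlet_cvg hz)).
Qed.

(** * Convergence of [M_F] on the whole plane *)

Section entire_series.
Variable F : R -> R.
Hypothesis F_ge0 : forall x : R, 0 <= x -> 0 <= F x.
Hypothesis F_superlinear : F x / x @[x --> +oo] --> +oo.

(** The coefficient of [z ^+ n.+1], with the index shift of [M_term]. *)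
Definition M_coef n : R := expR (- conjugate F n.+1%:R) / n.+1%:R ^+ 2.

Lemma M_coef_gt0 n : 0 < M_coef n.
Proof. by rewrite divr_gt0 ?expR_gt0// exprn_gt0. Qed.

Lemma M_termE z n : M_term F z n = (M_coef n)%:C * z ^+ n.+1.
Proof.
rewrite /M_term /M_coef rmorphM fmorphV rmorphXn/= rmorph_nat.
by rewrite [RHS]mulrC mulrA mulrAC.
Qed.

Lemma conjugate_ge y A : 0 <= A -> A * y - F A <= conjugate F y.
Proof.
move=> A0; apply: ub_le_sup; last by exists A.
by case: (has_sup_conjugate y F_ge0 F_superlinear).
Qed.

(** The Fenchel-Young inequality [conjugate_ge] at [A] bounds [M_coef n] by
    [expR (F A) * expR (- A) ^+ n.+1]; taking [A] to be [ln (1 + 2 * Z)] makes the ratio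
    [expR (- A) * Z] at most [1 / 2]. *)
Lemma M_majorant_cvg Z : 0 <= Z -> cvgn (series (fun n => M_coef n * Z ^+ n.+1)).
Proof.
move=> Z0; pose A := ln (1 + 2 * Z).
have Z1 : 1 <= 1 + 2 * Z by rewrite lerDl mulr_ge0.
have Zp : 0 < 1 + 2 * Z by rewrite (lt_le_trans _ Z1).
have A0 : 0 <= A by exact: ln_ge0.
have q1 : `|1 / 2| < 1 :> R by rewrite ger0_norm ?divr_ge0//; lra.
apply: (series_le_cvg _ _ _ (is_cvg_geometric_series (a := expR (F A)) q1)) => n.
- by rewrite mulr_ge0 ?exprn_ge0// ltW// M_coef_gt0.
- by rewrite /geometric/= mulr_ge0 ?expR_ge0// exprn_ge0// divr_ge0.
rewrite /geometric/=.
have h1 : M_coef n <= expR (F A) * expR (- A) ^+ n.+1.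
  apply: (@le_trans _ _ (expR (- conjugate F n.+1%:R))).
    by rewrite ler_pdivrMr ?exprn_gt0// ler_peMr ?expR_ge0// exprn_ege1// ler1n.
  rewrite -expRM_natl -expRD ler_expR; have := conjugate_ge n.+1%:R A0.
  by rewrite -mulr_natl; lra.
apply: le_trans (ler_wpM2r (exprn_ge0 n.+1 Z0) h1) _.
rewrite -mulrA -exprMn ler_wpM2l ?expR_ge0//.
have h2 : 0 <= expR (- A) * Z <= 1 / 2.
  rewrite mulr_ge0 ?expR_ge0//= expRN lnK ?posrE// mulrC ler_pdivrMr//; lra.
case/andP: h2 => h20 h2.
rewrite (le_trans (lerXn2r n.+1 _ _ h2)) ?nnegrE ?divr_ge0//.
by rewrite exprS ler_piMl ?exprn_ge0 ?divr_ge0//; lra.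
Qed.

End entire_series.

End exponential_character.

(** * Coefficients of the composition and their lower bound *)

Theorem theorem3 (R : realType) (F : R -> R) (g : nat -> R)
  (F_ge0 : forall x : R, 0 <= x -> 0 <= F x)
  (F_incr : forall x y : R, 0 <= x -> x <= y -> F x <= F y)
  (F_superlinear : F x / x @[x --> +oo] --> +oo)
  (g_abs_cvg : forall s : R[i], 1 < complex.Re s ->
     cvgn [normed series (dirichlet_term g s)])
  (g_ge1 : forall n : nat, (0 < n)%N -> 1 <= g n) :
  exists a : nat -> R,
    (forall s : R[i], 1 < complex.Re s ->
       cvgn (series (M_term F (dirichlet g s))) /\
       cvgn (series (dirichlet_term a s)) /\
       M_ F (dirichlet g s) = dirichlet a s) /\
    \forall x \near +oo, forall k : nat, (0 < k)%N ->
      expR (ln k%:R * (ln x / ln (ln x)) - conjugate F k%:R)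
      <= sup [set a n | n in [set n : nat | (0 < n)%N && (n%:R <= x)]].
Proof.
have g0 d : (0 < d)%N -> 0 <= g d by move=> /g_ge1; apply: le_trans.
pose c := M_coef F.
have c0 m : 0 <= c m by exact/ltW/M_coef_gt0.
have f0 m d : (0 < d)%N -> 0 <= dpow g m.+1 d by move=> _; exact: dpow_ge0.
have t0 m n : (0 < n)%N -> 0 <= c m * dpow g m.+1 n by move=> n0; rewrite mulr_ge0 ?f0.
pose W s n : R := Normc.normc (natpow s n).
have W0 s n : 0 <= W s n by exact: normc_ge0.
have maj s : 1 < complex.Re s -> exists Z, [/\ 0 <= Z,
    cvgn (series (fun m => c m * Z ^+ m.+1)) &
    forall m, majorized (natpow s) (W s) (dpow g m) (dirichlet g s ^+ m) (Z ^+ m)].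
  move=> s1; have [Z mg] := abs_cvg_majorized g0 (g_abs_cvg s s1).
  have Z0 : 0 <= Z by rewrite (le_trans (normc_ge0 _) (majorized_norm mg)).
  exists Z; split => //; first exact: M_majorant_cvg.
  by move=> m; apply: majorized_dpow => //; [exact: natpow1|exact: natpowM].
pose a n := limn (series (fun m => c m * dpow g m.+1 n)).
have acv n : (0 < n)%N -> cvgn (series (fun m => c m * dpow g m.+1 n)).
  (* One point of convergence controls all coefficients: at [s = 2] a single term is at most the
     whole sum, so [dpow g m.+1 n * W 2%:C n <= Z ^+ m.+1]. *)
  move=> n0; have [|Z [Z0 cvZ mZ]] := maj (2%:C); first by rewrite /=; lra.
  have Wn : 0 < W 2%:C n by exact: W_gt0.
  apply: (@series_le_cvg _ _ (fun m => (W 2%:C n)^-1 * (c m * Z ^+ m.+1))) => [m|m|m|].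
  - exact: t0.
  - by rewrite mulr_ge0 ?invr_ge0 ?W0// mulr_ge0 ?exprn_ge0.
  - rewrite [leRHS]mulrC ler_pdivlMr// -mulrA ler_wpM2l//.
    rewrite (le_trans _ (majorized_le n (mZ m.+1)))//.
    case: n n0 {Wn} => // n _; rewrite psumS lerDr psum_ge0// => d d0.
    exact: dpow_ge0.
  - by apply: is_cvg_seriesZ; exact: cvZ.
have ca n : (0 < n)%N -> series (fun m => c m * dpow g m.+1 n) @ \oo --> a n.
  by move=> /acv.
have a_ge m n : (0 < n)%N -> c m * dpow g m.+1 n <= a n.
  move=> n0; apply: (@le_trans _ _ (series (fun m => c m * dpow g m.+1 n) m.+1)).
    rewrite /series/= big_nat_recr//= lerDr sumr_ge0// => i _; exact: t0.
  apply: nondecreasing_cvgn_le; last exact: acv.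
  by apply: nondecreasing_series => i _ _; exact: t0.
exists a; split.
  move=> s s1; have [Z [Z0 cvZ mZ]] := maj s s1.
  set z := dirichlet g s in mZ *.
  have [|zz hzz] := @dominated_series R (M_term F z) (fun m => c m * Z ^+ m.+1) _ _ cvZ.
    move=> m; rewrite M_termE Normc.normcM normc_real// ler_wpM2l// normcX.
    rewrite lerXn2r ?nnegrE ?normc_ge0//.
    by have := majorized_norm (mZ 1%N); rewrite !expr1.
  have Mz : series (M_term F z) @ \oo --> (zz : cplx R).
    apply: (cvg_cplx hzz); rewrite -(subrr (limn (series (fun m => c m * Z ^+ m.+1)))).
    by apply: cvgB => //; exact: cvg_cst.
  have ma : majorized (natpow s) (W s) a zz (limn (series (fun m => c m * Z ^+ m.+1))).
    apply: (@majorized_series _ _ _ _ _ c (fun m => dpow g m.+1) a (fun m => z ^+ m.+1)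
      (fun m => Z ^+ m.+1)) => // K.
    by under eq_bigr do rewrite -M_termE; exact: hzz.
  have Da := dirichlet_cvg ma.
  split; first exact: cvgP Mz.
  split; first exact: cvgP Da.
  by rewrite /M_ /dirichlet (cvg_cplx_lim Mz) (cvg_cplx_lim Da).
(* The threshold for [x] comes only from [primorial_many_primes], so it is uniform in [k]. *)
near=> x => k k0.
have [y [yx hy]] : exists y, (primorial y)%:R <= x /\
    ln x / ln (ln x) + 2 <= (prime_count y)%:R by near: x; exact: primorial_many_primes.
have a0 n : (0 < n)%N -> 0 <= a n.
  by move=> n0; rewrite (le_trans _ (a_ge 0%N n n0))// t0.
(* Without an upper bound [sup] would be a default value; the sum of all [a n] up to [Num.bound x]
   is one. *)
have ub : has_ubound [set a n | n in [set n : nat | (0 < n)%N && (n%:R <= x)]].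
  have x0 : 0 <= x by rewrite (le_trans _ yx).
  exists (\sum_(1 <= n < (Num.bound x).+1) a n) => _ [n /= /andP[n0 nx] <-].
  have nb : (n < (Num.bound x).+1)%N.
    by rewrite ltnS -(ler_nat R) (le_trans nx)// ltW// archi_boundP.
  rewrite (big_cat_nat (n := n))//= ?(ltnW nb)// [X in _ + X]big_ltn//.
  rewrite addrCA lerDl addr_ge0// big_nat_cond sumr_ge0// => i /andP[/andP[i0 _] _].
    exact: a0.
  by rewrite a0// (leq_ltn_trans _ i0).
apply: (@le_trans _ _ (a (primorial y))); last first.
  by apply: (ub_le_sup ub); exists (primorial y) => //=; rewrite primorial_gt0.
(* From here on [k.+1] is the given number, and the power [g ^ k.+1] has index [k] in the series. *)
case: k k0 => // k _; apply: le_trans (a_ge k _ (primorial_gt0 y)).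
apply: le_trans (ler_wpM2l (c0 k) (dpow_primorial k.+1 y g_ge1)).
have kE j : k.+1%:R ^+ j = expR (ln k.+1%:R * j%:R) :> R.
  by rewrite mulrC expRM_natl lnK// posrE.
rewrite /c /M_coef !kE -expRN -!expRD ler_expR.
(* The [2] in [hy], multiplied by [ln k.+1%:R >= 0], cancels the denominator [k.+1%:R ^+ 2] of
   [M_coef]. *)
have := ler_wpM2l (ln_ge0 (_ : 1 <= k.+1%:R :> R)) hy; rewrite ler1n => /(_ isT).
lra.
Unshelve. all: by end_near. Qed.
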